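(* Let $\mathcal H$ be a complex Hilbert space and let $A,B,C,D\in B(\mathcal H)$. Then $$w^2(B^*A+DC^* )\le \frac12\Big[\big\||A^*B|^2+|CD^*|^2\big\|+\big\||A^*B|^2-|CD^*|^2\big\|\Big]+w(DC^*A^*B)+2\,w(B^*A)\,w(DC^* ).$$
   Context: $B(\mathcal H)$ is the $C^*$-algebra of bounded linear operators on $\mathcal H$ and $\|\cdot\|$ is the usual operator norm. For $T\in B(\mathcal H)$, $w(T)=\sup\{|\langle T\xi,\xi\rangle|:\xi\in\mathcal H,\ \|\xi\|=1\}$ is the numerical radius, $w^2(T)=(w(T))^2$, and $|T|=(T^*T)^{1/2}$. *)

(* Defs.v *)
From HB Require Import structures.
From mathcomp Require Import all_boot all_order all_algebra.
From mathcomp Require Import complex.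
From mathcomp Require Import all_classical all_reals all_analysis.
Import Order.TTheory GRing.Theory Num.Theory.
Import numFieldNormedType.Exports.

Set Implicit Arguments.
Unset Strict Implicit.
Unset Printing Implicit Defensive.

Local Open Scope classical_set_scope.
Local Open Scope ring_scope.

(* The inner product is linear in its first argument and conjugate-linear in
   the second; the norm of the complete normed space [H] is the one it
   induces. *)
HB.mixin Record CompleteNormedModule_isHilbert (R : realType) H
    of CompleteNormedModule R[i] H := {
  inner : {dot H for (@Num.conj R[i])} ;
  sqr_norm_inner : forall x : H, `|x| ^+ 2 = inner x x
}.

#[short(type="hilbertType")]
HB.structure Definition Hilbert (R : realType) :=
  {H of CompleteNormedModule R[i] H & CompleteNormedModule_isHilbert R H}.

Section Operators.
Context {R : realType} {H : hilbertType R}.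
Implicit Types T P S : H -> H.

Definition bounded_operator T : Prop :=
  linear T /\ exists M : R, forall x, `|T x| <= M%:C%C * `|x|.

(* By the Riesz representation theorem the set below is a singleton when [T]
   is a bounded operator. *)
Definition adjoint T : H -> H :=
  fun y => xget 0 [set z | forall x, inner (T x) y = inner x z].

Definition positive_operator P : Prop :=
  bounded_operator P /\ forall x, 0 <= inner (P x) x.

(* A positive operator [S] has exactly one positive square root. *)
Definition sqrt_operator S : H -> H :=
  xget (fun=> 0) [set P | positive_operator P /\ P \o P = S].

Definition abs_operator T : H -> H := sqrt_operator (adjoint T \o T).

(* Norms and moduli have values in [R[i]]; they are real, so [complex.Re] only
   changes their type.  On the zero space both suprema are [0]. *)
Definition operator_norm T : R :=
  sup [set complex.Re `|T x| | x in [set x | `|x| <= 1]].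

Definition numerical_radius T : R :=
  sup [set complex.Re `|inner (T x) x| | x in [set x | `|x| = 1]].

End Operators.

(* Main.v *)
Require Import Defs.
From mathcomp Require Import all_boot all_order all_algebra.
From mathcomp Require Import complex lra ring.
From mathcomp Require Import all_classical all_reals all_analysis.
Import Order.TTheory GRing.Theory Num.Theory.
Import numFieldNormedType.Exports.

(** Put [X = B^* A] and [Y = D C^*], so that [X^* = A^* B], [Y^* = C D^*] and
[D C^* A^* B = Y X^*].  For a unit vector [x],
[|<(X + Y) x, x>|^2 <= |<X x, x>|^2 + |<Y x, x>|^2 + 2 |<X x, x>| |<Y x, x>|],
and the last term is at most [2 w(X) w(Y)].  With [y = X^* x] and [z = Y^* x]
the first two terms are [|<x, y>|^2 + |<x, z>|^2], which [Bombieri] bounds by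
[max (|y|^2, |z|^2) + |<y, z>|].  Here [<y, z> = <Y X^* x, x>] is at most
the numerical radius of [Y X^*], and the maximum of two reals is half the sum of
their sum and of the absolute value of their difference, where
[|y|^2 +- |z|^2 = <(|X^*|^2 +- |Y^*|^2) x, x>] is at most the operator norm of
[|X^*|^2 +- |Y^*|^2] in absolute value.

This uses two facts about operators, both of which rest on completeness.

- The adjoint exists ([adjointP]), by the Riesz representation theorem: the
  representing vector is the limit of a minimising sequence of
  [x |-> |x|^2 - 2 Re (f x)], which is a Cauchy sequence by the parallelogram
  identity ([Riesz_representation]).
- [|T|^2 = T^* T] ([abs_operator_sqr]), which requires a positive square root
  of [T^* T] to exist.  After scaling, [T^* T = 1 - A] for a symmetric
  contraction [A], and the square root is [1 - L] where [L] is the limit of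
  [L_0 = 0], [L_(n+1) = (A + L_n^2) / 2], hence a solution of
  [2 L = A + L^2], that is, of [(1 - L)^2 = 1 - A].  Comparison with the scalar
  sequence obtained for [A = 1] shows that the iterates converge at rate
  [O(1/n)] ([sqrt_iter_cauchy]).

All limits are handled through explicit bounds of the form [K / (n + 1)]. *)

Set Implicit Arguments.
Unset Strict Implicit.
Unset Printing Implicit Defensive.

Local Open Scope classical_set_scope.
Local Open Scope ring_scope.

(** * Real-valued norms and convergence at rate [1/n] *)

Section RealNorm.
Context {R : realType}.

(** Norms take values in [R[i]], whose order is partial; the same numbers in [R]
allow the tactics for linear and nonlinear real arithmetic to be used. *)
Definition rnorm {V : normedZmodType R[i]} (x : V) : R := complex.Re `|x|.

Lemma rnormE (V : normedZmodType R[i]) (x : V) : `|x| = (rnorm x)%:C%C.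
Proof. by rewrite [RHS]RRe_real// normr_real. Qed.

Lemma rnorm_ge0 (V : normedZmodType R[i]) (x : V) : 0 <= rnorm x.
Proof. by rewrite -lecR -rnormE; exact: normr_ge0. Qed.

Lemma ler_rnormD (V : normedZmodType R[i]) (x y : V) :
  rnorm (x + y) <= rnorm x + rnorm y.
Proof. by rewrite -lecR rmorphD/= -!rnormE; exact: ler_normD. Qed.

Lemma rnormN (V : normedZmodType R[i]) (x : V) : rnorm (- x) = rnorm x.
Proof. by rewrite /rnorm normrN. Qed.

Lemma rnorm0 (V : normedZmodType R[i]) : rnorm (0 : V) = 0.
Proof. by rewrite /rnorm normr0. Qed.

Lemma rnorm_le0 (V : normedZmodType R[i]) (x : V) : rnorm x <= 0 -> x = 0.
Proof.
by move=> h; apply/eqP; rewrite -normr_eq0 rnormE eq_le lecR h lecR rnorm_ge0.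
Qed.

Lemma rnormZ (V : normedModType R[i]) (a : R[i]) (x : V) :
  rnorm (a *: x) = rnorm a * rnorm x.
Proof. by apply: complexI; rewrite rmorphM/= -!rnormE normrZ. Qed.

Lemma rnormM (a b : R[i]) : rnorm (a * b) = rnorm a * rnorm b.
Proof. by apply: complexI; rewrite rmorphM/= -!rnormE normrM. Qed.

Lemma rnormC (r : R) : rnorm r%:C%C = `|r|.
Proof. by rewrite /rnorm normc_def/= expr0n addr0 sqrtr_sqr. Qed.

Lemma ler_Re_rnorm (z : R[i]) : `|complex.Re z| <= rnorm z.
Proof. by rewrite -lecR -rnormE normc_ge_Re. Qed.

Lemma ReD (u v : R[i]) : complex.Re (u + v) = complex.Re u + complex.Re v.
Proof. by case: u v => [? ?] [? ?]. Qed.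

Lemma ReN (u : R[i]) : complex.Re (- u) = - complex.Re u.
Proof. by case: u. Qed.

Lemma ReMr (r : R) (u : R[i]) : complex.Re (r%:C%C * u) = r * complex.Re u.
Proof. by case: u => ? ?; rewrite /= mul0r subr0. Qed.

Lemma conj_real (r : R) : Num.conj r%:C%C = r%:C%C.
Proof. by apply/eqP; rewrite eq_complex /= oppr0 !eqxx. Qed.

Lemma le0_harmonic (a K : R) : (forall n, a <= K / n.+1%:R) -> a <= 0.
Proof.
move=> h; rewrite leNgt; apply/negP => a0.
have K0 : 0 < K by have := h 0%N; rewrite divr1; apply: lt_le_trans.
have := h (Num.truncn (K / a)).
rewrite ler_pdivlMr// -ler_pdivlMl// mulrC leNgt.
by rewrite truncnS_gt.
Qed.

(** Completeness in quantitative form: a Cauchy sequence with an explicit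
modulus converges with that same modulus, so that what follows needs estimates
at finite stages only, which [le0_harmonic] turns into identities. *)
Lemma complete_harmonic (V : completeNormedModType R[i]) (u : nat -> V) (K : R) :
  (forall n m, (n <= m)%N -> rnorm (u m - u n) <= K / n.+1%:R) ->
  exists l, forall n, rnorm (l - u n) <= K / n.+1%:R.
Proof.
move=> hu.
have uc : cvg (u @ \oo).
  apply/cauchy_cvgP/cauchy_exP => e e0.
  have e'0 : 0 < complex.Re e by move: e0; rewrite ltcE => /andP[].
  have eE : e = (complex.Re e)%:C%C by rewrite RRe_real// gtr0_real.
  pose N := Num.truncn (K / complex.Re e).
  exists (u N); exists N => // n /= Nn.
  rewrite -ball_normE/= distrC eE rnormE ltcR.
  apply: le_lt_trans (hu _ _ Nn) _.
  by rewrite ltr_pdivrMr// mulrC -ltr_pdivrMr// truncnS_gt.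
have /cvg_ex[l ul] := uc.
exists l => n; apply/ler_addgt0Pr => d d0.
have /cvgrPdist_lt /(_ d%:C%C) := ul.
rewrite ltcR => /(_ d0)[N _ hN].
have := hN (maxn N n) (leq_maxl _ _); rewrite /= rnormE ltcR => h1.
have h2 := hu n (maxn N n) (leq_maxr _ _).
rewrite (_ : l - u n = (u (maxn N n) - u n) + (l - u (maxn N n))); last first.
  by rewrite [RHS]addrC addrA subrK.
by apply: le_trans (ler_rnormD _ _) _; rewrite lerD// ltW.
Qed.

Lemma half_real : (2^-1 : R[i]) = (2^-1 : R)%:C%C.
Proof. by rewrite fmorphV rmorph_nat. Qed.

Lemma rnorm_half (V : normedModType R[i]) (x : V) :
  rnorm ((2^-1 : R[i]) *: x) = 2^-1 * rnorm x.
Proof. by rewrite half_real rnormZ rnormC ger0_norm ?invr_ge0. Qed.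

End RealNorm.

(** * The inner product *)

Section InnerProduct.
Context {R : realType} {H : hilbertType R}.
Implicit Types (x y z : H) (a : R[i]).

Lemma innerDl x y z : inner (x + y) z = inner x z + inner y z.
Proof. exact: linearDl. Qed.
Lemma innerDr x y z : inner x (y + z) = inner x y + inner x z.
Proof. exact: linearDr. Qed.
Lemma innerBl x y z : inner (x - y) z = inner x z - inner y z.
Proof. exact: linearBl. Qed.
Lemma innerBr x y z : inner x (y - z) = inner x y - inner x z.
Proof. exact: linearBr. Qed.
Lemma innerNr x y : inner x (- y) = - inner x y.
Proof. exact: linearNr. Qed.
Lemma innerZl a x y : inner (a *: x) y = a * inner x y.
Proof. exact: linearZl_LR. Qed.
Lemma innerZr a x y : inner x (a *: y) = Num.conj a * inner x y.
Proof. exact: linearZr_LR. Qed.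
Lemma innerC x y : inner x y = Num.conj (inner y x).
Proof. by rewrite (hermC inner) mul1r. Qed.

Lemma inner_self x : inner x x = (rnorm x ^+ 2)%:C%C.
Proof. by rewrite -sqr_norm_inner rnormE rmorphXn. Qed.

Lemma rnorm_sqr x : rnorm x ^+ 2 = complex.Re (inner x x).
Proof. by rewrite inner_self. Qed.

Lemma Re_innerC x y : complex.Re (inner x y) = complex.Re (inner y x).
Proof. by rewrite innerC; case: (inner y x). Qed.

Lemma rnorm_sqrD x y :
  rnorm (x + y) ^+ 2 = rnorm x ^+ 2 + rnorm y ^+ 2 + 2 * complex.Re (inner x y).
Proof.
by rewrite !rnorm_sqr innerDl !innerDr !ReD (Re_innerC y x); ring.
Qed.

Lemma rnorm_sqrB x y :
  rnorm (x - y) ^+ 2 = rnorm x ^+ 2 + rnorm y ^+ 2 - 2 * complex.Re (inner x y).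
Proof. by rewrite rnorm_sqrD rnormN innerNr ReN mulrN. Qed.

(** The vector [|y|^2 x - <x, y> y] is [|y|^2] times the component of [x]
orthogonal to [y]; this form of it avoids dividing by [|y|^2]. *)
Lemma CauchySchwarz_inner x y : rnorm (inner x y) <= rnorm x * rnorm y.
Proof.
have [->|y0] := eqVneq y 0.
  by rewrite (linear0r inner) !rnorm0 mulr0.
have ny : 0 < rnorm y.
  by rewrite lt_neqAle rnorm_ge0 andbT eq_sym; apply: contra y0 => /eqP h;
     apply/eqP/rnorm_le0; rewrite h.
set p := inner x y.
have := sqr_ge0 (rnorm ((rnorm y ^+ 2)%:C%C *: x - p *: y)).
rewrite rnorm_sqrB !rnormZ innerZr innerZl -/p mulrCA (mulrC _ p) -normCK.
rewrite rnormE -rmorphXn -rmorphM/= rnormC ger0_norm ?sqr_ge0// => h.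
have {}h : 0 <= rnorm y ^+ 2 * ((rnorm x * rnorm y) ^+ 2 - rnorm p ^+ 2).
  by apply: le_trans h _; rewrite le_eqVlt; apply/orP; left; apply/eqP; ring.
rewrite pmulr_rge0 ?exprn_gt0// subr_ge0 in h.
by rewrite -(@ler_pXn2r _ 2)// nnegrE ?mulr_ge0 ?rnorm_ge0.
Qed.

End InnerProduct.

(** * The Riesz representation theorem *)

Section Riesz.
Context {R : realType} {H : hilbertType R}.
Implicit Types (x y z : H) (a : R[i]).

Lemma parallelogram x y :
  rnorm (x - y) ^+ 2 =
  2 * rnorm x ^+ 2 + 2 * rnorm y ^+ 2 - 4 * rnorm ((2^-1 : R[i]) *: (x + y)) ^+ 2.
Proof.
by rewrite rnorm_half rnorm_sqrB exprMn rnorm_sqrD; field.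
Qed.

(** If [f = <-, z>], then [|x|^2 - 2 Re (f x) = |x - z|^2 - |z|^2], so [z] can
only be the point where this functional [J] of [x] is least.  Boundedness of [f]
makes [J] bounded below, and the parallelogram identity makes every minimising
sequence converge.  Comparing the values of [J] at [u n] and at [u n + e y]
identifies the real parts of [f] and of [<-, z>]. *)
Lemma Riesz_representation (f : H -> R[i]) (M : R) :
  scalar f ->
  (forall x, rnorm (f x) <= M * rnorm x) ->
  exists z, forall x, f x = inner x z.
Proof.
move=> fl fM.
have f0 : f 0 = 0 by have := fl (-1) 0 0; rewrite scaler0 addr0 mulN1r addNr.
have fD x y : f (x + y) = f x + f y by have := fl 1 x y; rewrite scale1r mul1r.
have fZ a x : f (a *: x) = a * f x by have := fl a x 0; rewrite f0 !addr0.
pose J x : R := rnorm x ^+ 2 - 2 * complex.Re (f x).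
pose m := inf (range J).
have Jlb : has_inf (range J).
  split; first by exists (J 0); exists 0.
  exists (- M ^+ 2) => _ [x _ <-]; rewrite /J.
  have h1 := le_trans (ler_norm _) (le_trans (ler_Re_rnorm _) (fM x)).
  by have := sqr_ge0 (rnorm x - M); nra.
have mJ x : m <= J x by apply: ge_inf; [case: Jlb | exists x].
pose e n : R := n.+1%:R^-1.
have e0 n : 0 < e n by rewrite invr_gt0.
have /choice[u hu] n : exists x, J x < m + e n ^+ 2.
  have [_ [x _ <-] h] := inf_adherent (exprn_gt0 2 (e0 n)) Jlb.
  by exists x.
have [z hz] : exists z, forall n, rnorm (z - u n) <= 2 / n.+1%:R.
  apply: complete_harmonic => n k nk; rewrite -/(e n).
  have ek : e k <= e n by rewrite lef_pV2 ?posrE// ler_nat.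
  rewrite -(@ler_pXn2r _ 2)// ?nnegrE ?rnorm_ge0 ?mulr_ge0 ?ltW// parallelogram.
  have := mJ ((2^-1 : R[i]) *: (u k + u n)); have := hu n; have := hu k.
  rewrite /J fZ fD.
  have -> : complex.Re (2^-1 * (f (u k) + f (u n))) =
            2^-1 * (complex.Re (f (u k)) + complex.Re (f (u n))).
    by rewrite half_real ReMr ReD.
  have ek2 : e k ^+ 2 <= e n ^+ 2 by rewrite ler_pXn2r// ?nnegrE ltW.
  by move: ek2; rewrite exprMn; lra.
have ReE x : complex.Re (inner x z) = complex.Re (f x).
  (* The increment e is the square root of the defect of u n, so that dividing
     J (u n) <= J (u n + e y) + e^2 by e leaves an error of order e. *)
  have key n y : complex.Re (f y) - complex.Re (inner y (u n)) <=
                 ((rnorm y ^+ 2 + 1) / 2) / n.+1%:R.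
    rewrite -/(e n).
    have := mJ ((e n)%:C%C *: y + u n); have := hu n.
    rewrite /J fl ReD rnorm_sqrD rnormZ rnormC ger0_norm ?(ltW (e0 n))// innerZl.
    rewrite !ReMr => h1 h2.
    have := e0 n => en.
    rewrite -(ler_pM2l en); nra.
  have key2 y : complex.Re (f y) - complex.Re (inner y z) <= 0.
    apply: (@le0_harmonic _ _ ((rnorm y ^+ 2 + 1) / 2 + rnorm y * 2)) => n.
    rewrite mulrDl; have := key n y.
    have hn : rnorm (u n - z) <= 2 / n.+1%:R by rewrite -rnormN opprB.
    have := le_trans (ler_norm _) (le_trans (ler_Re_rnorm _)
      (le_trans (CauchySchwarz_inner y (u n - z)) (ler_wpM2l (rnorm_ge0 y) hn))).
    by rewrite innerBr ReD ReN mulrA => h1 h2; have := lerD h2 h1; rewrite addrA subrK.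
  (* Replacing x by - x turns the inequality into an equality. *)
  have := key2 x; have := key2 ((-1) *: x).
  rewrite fZ innerZl !mulN1r !ReN => h1 h2.
  by apply/eqP; rewrite eq_le; apply/andP; split; move: h1 h2; lra.
exists z => x; apply/eqP; rewrite eq_complex ReE eqxx/=.
(* Up to sign, the imaginary part at x is the real part at i x. *)
have := ReE ('i%C *: x).
by rewrite fZ innerZl 2!(mulrC 'i%C) !ReiNIm => /oppr_inj ->.
Qed.

End Riesz.

(** * Bounded operators and adjoints *)

Section Adjoint.
Context {R : realType} {H : hilbertType R}.
Implicit Types (x y z : H) (a : R[i]) (T S : H -> H).

Lemma linear_opD T : linear T -> forall x y, T (x + y) = T x + T y.
Proof. by move=> hT x y; have := hT 1 x y; rewrite !scale1r. Qed.

Lemma linear_op0 T : linear T -> T 0 = 0.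
Proof.
by move=> hT; apply: (addrI (T 0)); rewrite -linear_opD// !addr0.
Qed.

Lemma linear_opZ T : linear T -> forall a x, T (a *: x) = a *: T x.
Proof. by move=> hT a x; rewrite -[a *: x]addr0 hT linear_op0 ?addr0. Qed.

Lemma linear_opB T : linear T -> forall x y, T (x - y) = T x - T y.
Proof. by move=> hT x y; rewrite linear_opD// -scaleN1r linear_opZ// scaleN1r. Qed.

Lemma bounded_operatorP T :
  bounded_operator T <->
  linear T /\ exists2 c, 0 <= c & forall x, rnorm (T x) <= c * rnorm x.
Proof.
split=> -[lT].
  move=> [c hc]; split => //; exists `|c| => // x.
  apply: (@le_trans _ _ (c * rnorm x)); last by rewrite ler_wpM2r ?rnorm_ge0 ?ler_norm.
  by have := hc x; rewrite !rnormE -rmorphM lecR.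
move=> [c c0 hc]; split => //; exists c => x.
by rewrite !rnormE -rmorphM lecR.
Qed.

Lemma bounded_operator_comp T S :
  bounded_operator T -> bounded_operator S -> bounded_operator (T \o S).
Proof.
move=> /bounded_operatorP[lT [c c0 hc]] /bounded_operatorP[lS [d d0 hd]].
apply/bounded_operatorP; split; first by move=> a x y /=; rewrite lS lT.
exists (c * d) => [|x]; first exact: mulr_ge0.
by rewrite -mulrA; apply: le_trans (hc _) _; rewrite ler_wpM2l.
Qed.

Lemma bounded_operator_add T S :
  bounded_operator T -> bounded_operator S -> bounded_operator (T \+ S).
Proof.
move=> /bounded_operatorP[lT [c c0 hc]] /bounded_operatorP[lS [d d0 hd]].
apply/bounded_operatorP; split.
  by move=> a x y /=; rewrite lS lT scalerDr addrACA.
exists (c + d) => [|x]; first exact: addr_ge0.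
by rewrite mulrDl; apply: le_trans (ler_rnormD _ _) _; rewrite lerD.
Qed.

Lemma bounded_operatorZ a T : bounded_operator T -> bounded_operator (a \*: T).
Proof.
move=> /bounded_operatorP[lT [c c0 hc]]; apply/bounded_operatorP; split.
  by move=> b x y /=; rewrite lT scalerDr !scalerA mulrC.
exists (rnorm a * c) => [|x /=]; first by rewrite mulr_ge0// rnorm_ge0.
by rewrite rnormZ -mulrA ler_wpM2l// rnorm_ge0.
Qed.

Lemma bounded_operator_sub T S :
  bounded_operator T -> bounded_operator S -> bounded_operator (T \- S).
Proof.
move=> bT /(bounded_operatorZ (-1))/(bounded_operator_add bT).
by congr bounded_operator; apply/funext => x /=; rewrite scaleN1r.
Qed.

Lemma inner_inj y z : (forall x, inner x y = inner x z) -> y = z.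
Proof.
move=> h; apply/eqP; rewrite -subr_eq0; apply/eqP/rnorm_le0.
by rewrite -(@ler_pXn2r _ 2) ?nnegrE ?rnorm_ge0// rnorm_sqr innerBr h subrr expr0n.
Qed.

(** The defining property of the adjoint, whose existence is that of a vector
representing the bounded functional [x |-> <T x, y>]. *)
Lemma adjointP T : bounded_operator T ->
  forall x y, inner (T x) y = inner x (adjoint T y).
Proof.
move=> /bounded_operatorP[lT [c c0 hc]] x y.
have [z hz] : exists z, forall x, inner (T x) y = inner x z.
  apply: (@Riesz_representation _ _ _ (c * rnorm y)) => [a u v|u].
    by rewrite lT innerDl innerZl.
  by rewrite mulrAC; apply: le_trans (CauchySchwarz_inner _ _) _;
     rewrite ler_wpM2r ?rnorm_ge0.
exact: (@xgetPex _ 0 [set z | forall x, inner (T x) y = inner x z] (ex_intro _ z hz)).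
Qed.

Lemma adjoint_le T c : bounded_operator T -> 0 <= c ->
  (forall x, rnorm (T x) <= c * rnorm x) ->
  forall y, rnorm (adjoint T y) <= c * rnorm y.
Proof.
move=> bT c0 hc y.
have [->|n0] := eqVneq (rnorm (adjoint T y)) 0; first by rewrite mulr_ge0 ?rnorm_ge0.
have p0 : 0 < rnorm (adjoint T y) by rewrite lt_neqAle eq_sym n0 rnorm_ge0.
rewrite -(ler_pM2l p0) -expr2 rnorm_sqr -adjointP//.
apply: le_trans (ler_norm _) _; apply: le_trans (ler_Re_rnorm _) _.
apply: le_trans (CauchySchwarz_inner _ _) _.
by rewrite mulrA (mulrC _ c) ler_wpM2r ?rnorm_ge0.
Qed.

Lemma bounded_adjoint T : bounded_operator T -> bounded_operator (adjoint T).
Proof.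
move=> bT; have /bounded_operatorP[lT [c c0 hc]] := bT.
apply/bounded_operatorP; split.
  move=> a y z; apply: inner_inj => x.
  by rewrite -adjointP// !innerDr !innerZr -!adjointP.
by exists c => // y; exact: adjoint_le.
Qed.

End Adjoint.

(** * Square roots of positive operators *)

Section SquareRoot.
Context {R : realType} {H : hilbertType R}.
Implicit Types (x y z : H) (a : R[i]) (T S : H -> H).

(** The iteration [X_(n+1) = (A + X_n^2) / 2] for the fixed point equation
[2 Y = A + Y^2], which says that [1 - Y] is a square root of [1 - A]. *)
Fixpoint sqrt_iter (A : H -> H) (n : nat) (x : H) : H :=
  if n is m.+1 then 2^-1 *: (A x + sqrt_iter A m (sqrt_iter A m x)) else 0.

(** The same iteration for the scalar [A = 1]; it increases to [1] and majorises
the norms of the iterates and of their increments. *)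
Fixpoint sqrt_bound (n : nat) : R :=
  if n is m.+1 then 2^-1 * (1 + sqrt_bound m ^+ 2) else 0.

Lemma sqrt_bound01 n : 0 <= sqrt_bound n <= 1.
Proof. by elim: n => [|n /andP[h0 h1]] /=; apply/andP; split; nra. Qed.

(** The gap [d = 1 - r] evolves by [d |-> d - d^2 / 2], which is increasing on
[[0, 1]] and maps [2 / t] to at most [2 / (t + 1)]. *)
Lemma sqrt_bound_lb n : 1 - sqrt_bound n <= 2 / n.+1%:R.
Proof.
(* The invariant is 2 / (n + 2): at n = 0 the gap is 1. *)
suff h : 1 - sqrt_bound n <= 2 / n.+2%:R.
  by apply: le_trans h _; rewrite ler_pM2l// lef_pV2 ?posrE// ler_nat.
elim: n => [|n IH]; first by rewrite /= subr0 divff.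
rewrite /=; have /andP[h0 h1] := sqrt_bound01 n.
move: IH; set r := sqrt_bound n.
rewrite !ler_pdivlMr// -[n.+3%:R]natr1; have : 2 <= n.+2%:R :> R by rewrite ler_nat.
move: (n.+2%:R : R) => t t2 h.
(* With s = (1 - r) t <= 2, this says s t - s^2 / 2 <= 2 t - 2. *)
have h3 : (2 - (1 - r) * t) * (t - (2 + (1 - r) * t) / 2) >= 0.
  by rewrite mulr_ge0 ?subr_ge0//; lra.
have t0 : 0 < t by lra.
rewrite -(ler_pM2l (exprn_gt0 2 t0)); nra.
Qed.

Context (A : H -> H) (lA : linear A) (cA : forall x, rnorm (A x) <= rnorm x)
  (sA : forall x y, inner (A x) y = inner x (A y)).

Local Notation X := (sqrt_iter A).
Local Notation r := sqrt_bound.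

Lemma sqrt_iter_linear n : linear (X n).
Proof.
elim: n => [|n IH] a x y /=; first by rewrite scaler0 addr0.
by rewrite lA !IH addrACA scalerDr -[a *: A x + _]scalerDr !scalerA mulrC.
Qed.

Lemma sqrt_iter_sym n x y : inner (X n x) y = inner x (X n y).
Proof.
elim: n x y => [|n IH] x y /=; first by rewrite (linear0l inner) (linear0r inner).
rewrite innerZl innerZr innerDl innerDr sA !IH.
by rewrite half_real conj_real.
Qed.

Lemma sqrt_iter_le n x : rnorm (X n x) <= r n * rnorm x.
Proof.
elim: n x => [|n IH] x /=; first by rewrite rnorm0 mul0r.
rewrite rnorm_half -mulrA ler_pM2l ?invr_gt0// mulrDl mul1r.
apply: le_trans (ler_rnormD _ _) _; rewrite lerD// expr2 -mulrA.
apply: le_trans (IH _) _; rewrite ler_wpM2l//.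
by case/andP: (sqrt_bound01 n).
Qed.

(** The difference of squares [U^2 - V^2 = U (U - V) + (U - V) V] holds without
commutation, and the scalar sequence satisfies the same recursion with
equality. *)
Lemma sqrt_iter_step n x : rnorm (X n.+1 x - X n x) <= (r n.+1 - r n) * rnorm x.
Proof.
elim: n x => [|n IH] x.
  by rewrite !subr0; exact: (sqrt_iter_le 1).
have -> : X n.+2 x - X n.+1 x =
    2^-1 *: (X n.+1 (X n.+1 x - X n x) + (X n.+1 (X n x) - X n (X n x))).
  rewrite (linear_opB (sqrt_iter_linear n.+1)).
  transitivity (2^-1 *: (A x + X n.+1 (X n.+1 x)) - 2^-1 *: (A x + X n (X n x)));
    first by [].
  by rewrite addrA subrK -scalerBr opprD addrACA subrr add0r.
rewrite rnorm_half.
have -> : r n.+2 - r n.+1 = 2^-1 * (r n.+1 * (r n.+1 - r n) + (r n.+1 - r n) * r n).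
  transitivity (2^-1 * (1 + r n.+1 ^+ 2) - 2^-1 * (1 + r n ^+ 2)); first by [].
  by ring.
rewrite -mulrA ler_pM2l ?invr_gt0// mulrDl.
have r0 k : 0 <= r k by case/andP: (sqrt_bound01 k).
have d0 : 0 <= r n.+1 - r n.
  by rewrite /=; have /andP[] := sqrt_bound01 n; have := sqr_ge0 (1 - r n); lra.
apply: le_trans (ler_rnormD _ _) _; apply: lerD.
  by apply: le_trans (sqrt_iter_le _ _) _; rewrite -mulrA ler_wpM2l.
apply: le_trans (IH _) _; rewrite -mulrA ler_wpM2l//; exact: sqrt_iter_le.
Qed.

Lemma sqrt_iter_cauchy n m x : (n <= m)%N ->
  rnorm (X m x - X n x) <= 2 * rnorm x / n.+1%:R.
Proof.
move=> nm.
have h : rnorm (X m x - X n x) <= (r m - r n) * rnorm x.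
  elim: m nm => [|m IH]; first by rewrite leqn0 => /eqP ->; rewrite !subrr rnorm0 mul0r.
  rewrite leq_eqVlt => /predU1P[->|/IH{}IH]; first by rewrite !subrr rnorm0 mul0r.
  rewrite -(subrKA (X m x)) -(subrKA (r m)) mulrDl.
  by apply: le_trans (ler_rnormD _ _) _; rewrite lerD// sqrt_iter_step.
apply: le_trans h _; rewrite mulrAC ler_wpM2r ?rnorm_ge0//.
apply: le_trans (sqrt_bound_lb n); rewrite lerB//.
by case/andP: (sqrt_bound01 m).
Qed.

Lemma sqrt_iter_limit : exists Y : H -> H, forall n x,
  rnorm (Y x - X n x) <= 2 * rnorm x / n.+1%:R.
Proof.
have /choice[Y hY] x : exists l, forall n, rnorm (l - X n x) <= 2 * rnorm x / n.+1%:R.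
  by apply: complete_harmonic => n m nm; exact: sqrt_iter_cauchy.
by exists Y => n x.
Qed.

End SquareRoot.

Section Sqrt.
Context {R : realType} {H : hilbertType R}.
Implicit Types (x y z : H) (a : R[i]) (T S : H -> H).
Local Notation X := sqrt_iter.

(** The root is [1 - Y] with [Y] the pointwise limit of the iterates.  The limit
is a symmetric contraction because every iterate is; this makes [1 - Y]
positive. *)
Lemma sqrt_id_sub (A : H -> H) : linear A ->
  (forall x, rnorm (A x) <= rnorm x) ->
  (forall x y, inner (A x) y = inner x (A y)) ->
  exists P, positive_operator P /\ forall x, P (P x) = x - A x.
Proof.
move=> lA cA sA.
have [Y hY] := sqrt_iter_limit lA cA.
have lX n := sqrt_iter_linear lA n.
have Xle n x : rnorm (X A n x) <= rnorm x.
  apply: le_trans (sqrt_iter_le cA n x) _; rewrite ler_piMl ?rnorm_ge0//.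
  by case/andP: (sqrt_bound01 (R := R) n).
have lY : linear Y.
  move=> a x y; apply/eqP; rewrite -subr_eq0; apply/eqP/rnorm_le0.
  apply: (@le0_harmonic _ _ (2 * rnorm (a *: x + y) +
            (rnorm a * (2 * rnorm x) + 2 * rnorm y))) => n.
  have -> : Y (a *: x + y) - (a *: Y x + Y y) =
      (Y (a *: x + y) - X A n (a *: x + y)) +
      (- (a *: (Y x - X A n x)) - (Y y - X A n y)).
    rewrite lX -opprD scalerBr [in RHS]addrACA -opprD opprB addrA subrK.
    by [].
  rewrite mulrDl.
  apply: le_trans (ler_rnormD _ _) _; apply: lerD; first exact: hY.
  rewrite mulrDl; apply: le_trans (ler_rnormD _ _) _; rewrite !rnormN rnormZ.
  apply: lerD; last exact: hY.
  by rewrite -mulrA ler_wpM2l ?rnorm_ge0.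
have cY x : rnorm (Y x) <= rnorm x.
  rewrite -subr_le0; apply: (@le0_harmonic _ _ (2 * rnorm x)) => n.
  rewrite lerBlDr; apply: le_trans (lerD (hY n x) (Xle n x)).
  by rewrite -{1}(subrK (X A n x) (Y x)) ler_rnormD.
have sY x y : inner (Y x) y = inner x (Y y).
  apply/eqP; rewrite -subr_eq0; apply/eqP/rnorm_le0.
  apply: (@le0_harmonic _ _ (2 * rnorm x * rnorm y + rnorm x * (2 * rnorm y))) => n.
  have -> : inner (Y x) y - inner x (Y y) =
      inner (Y x - X A n x) y - inner x (Y y - X A n y).
    by rewrite innerBl innerBr (sqrt_iter_sym sA); ring.
  apply: le_trans (ler_rnormD _ _) _; rewrite rnormN mulrDl; apply: lerD.
    apply: le_trans (CauchySchwarz_inner _ _) _.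
    by rewrite mulrAC ler_wpM2r ?rnorm_ge0.
  apply: le_trans (CauchySchwarz_inner _ _) _.
  by rewrite -mulrA ler_wpM2l ?rnorm_ge0.
have fixY x : Y (Y x) = 2 *: Y x - A x.
  apply/eqP; rewrite -subr_eq0; apply/eqP/rnorm_le0.
  apply: (@le0_harmonic _ _ (2 * rnorm (Y x) + 2 * rnorm x + 2 * (2 * rnorm x))) => n.
  have -> : Y (Y x) - (2 *: Y x - A x) =
     (Y (Y x) - X A n (Y x)) + X A n (Y x - X A n x) - 2 *: (Y x - X A n.+1 x).
    rewrite (linear_opB (lX n)) addrA subrK scalerBr /= scalerA divff// scale1r.
    rewrite !opprB -!addrA; congr (_ + _).
    by rewrite [RHS]addrCA addKr.
  apply: le_trans (ler_rnormD _ _) _; rewrite rnormN [leRHS]mulrDl; apply: lerD.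
    apply: le_trans (ler_rnormD _ _) _; rewrite mulrDl; apply: lerD; first exact: hY.
    by apply: le_trans (Xle _ _) (hY _ _).
  have -> : (2 : R[i]) = (2 : R)%:C%C by rewrite rmorph_nat.
  rewrite rnormZ rnormC ger0_norm// -!mulrA ler_pM2l// mulrA.
  apply: le_trans (hY _ _) _; rewrite ler_wpM2l ?mulr_ge0 ?rnorm_ge0//.
  by rewrite lef_pV2 ?posrE// ler_nat.
exists (fun x => x - Y x); split; last first.
  move=> x; rewrite (linear_opB lY) fixY scaler_nat mulr2n opprB.
  by rewrite [_ - A x - _]addrAC addrK addrA subrK.
split.
  apply/bounded_operatorP; split.
    by move=> a x y; rewrite lY scalerBr opprD addrACA.
  exists 2 => // x; apply: le_trans (ler_rnormD _ _) _.
  by rewrite rnormN mulrDl !mul1r lerD2l.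
move=> x; rewrite lecE innerBl inner_self.
have ImE : complex.Im (inner (Y x) x) = 0.
  have : complex.Im (inner (Y x) x) = - complex.Im (inner (Y x) x).
    by rewrite {1}sY innerC; case: (inner _ _).
  by lra.
have h : complex.Re (inner (Y x) x) <= rnorm x ^+ 2.
  apply: le_trans (ler_norm _) _; apply: le_trans (ler_Re_rnorm _) _.
  apply: le_trans (CauchySchwarz_inner _ _) _.
  by rewrite expr2 ler_wpM2r ?rnorm_ge0.
by move: ImE h; case: (inner (Y x) x) => u v /= -> h; rewrite subrr eqxx subr_ge0.
Qed.

(** With [|T x| <= M |x|] and [k = M^-2], the operator [A = 1 - k T^* T] is a
contraction: [|A x|^2 = |x|^2 - 2 k |T x|^2 + k^2 |T^* T x|^2] and
[|T^* T x| <= M |T x|].  The square root of [T^* T] is [M] times that of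
[1 - A]. *)
Lemma abs_operator_sqr T : bounded_operator T ->
  forall x, abs_operator T (abs_operator T x) = adjoint T (T x).
Proof.
move=> bT; have /bounded_operatorP[lT [c c0 hc]] := bT.
have bT' := bounded_adjoint bT.
have bTT := bounded_operator_comp bT' bT.
(* The bound c may be 0, and M has to be inverted. *)
pose M := c + 1; have M0 : 0 < M by rewrite ltr_wpDl.
have hM x : rnorm (T x) <= M * rnorm x.
  by apply: le_trans (hc x) _; rewrite ler_wpM2r ?rnorm_ge0// lerDl.
have hM' := adjoint_le bT (ltW M0) hM.
pose k := (M ^+ 2)^-1; have k0 : 0 < k by rewrite invr_gt0 exprn_gt0.
pose A x := x - k%:C%C *: adjoint T (T x).
have lA : linear A.
  move=> a x y; have TTE := bTT.1 a x y; rewrite /= in TTE.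
  by rewrite /A TTE !scalerDr opprD scalerN !scalerA mulrC addrACA.
have cA x : rnorm (A x) <= rnorm x.
  rewrite -(@ler_pXn2r _ 2) ?nnegrE ?rnorm_ge0// rnorm_sqrB rnormZ rnormC ger0_norm ?(ltW k0)//.
  have -> : complex.Re (inner x (k%:C%C *: adjoint T (T x))) = k * rnorm (T x) ^+ 2.
    by rewrite innerZr -adjointP// inner_self conj_real -rmorphM.
  have : k * rnorm (adjoint T (T x)) ^+ 2 <= rnorm (T x) ^+ 2.
    rewrite mulrC ler_pdivrMr ?exprn_gt0// mulrC -exprMn.
    by rewrite ler_pXn2r ?nnegrE ?mulr_ge0 ?rnorm_ge0// ltW.
  rewrite exprMn; nra.
have sA x y : inner (A x) y = inner x (A y).
  rewrite innerBl innerBr innerZl innerZr conj_real; congr (_ - _ * _).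
  by rewrite -adjointP// [LHS]innerC -adjointP// -innerC.
have [P [[bP pP] PP]] := sqrt_id_sub lA cA sA.
have /(xgetPex (fun=> 0))[_ h] : exists P : H -> H, positive_operator P /\ P \o P = adjoint T \o T.
  exists (M%:C%C \*: P); split; first split.
  - exact: bounded_operatorZ.
  - by move=> x /=; rewrite innerZl mulr_ge0// ler0c ltW.
  apply/funext => x /=; rewrite (linear_opZ bP.1) PP opprB addrCA subrr addr0 !scalerA.
  by rewrite -!rmorphM/= -expr2 mulfV ?scale1r// expf_neq0// gt_eqF.
by move=> x; have := congr1 (fun f => f x) h.
Qed.

End Sqrt.

(** * Numerical radius and operator norm *)

Section Radius.
Context {R : realType} {H : hilbertType R}.
Implicit Types (x y z : H) (a : R[i]) (T S : H -> H).

(** Bombieri's inequality for two vectors.  The left-hand side [s] equals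
[<x, u>] for [u = <x, y> y + <x, z> z], so [s^2 <= |x|^2 |u|^2] by
Cauchy-Schwarz, while expanding [|u|^2] bounds it by [s] times the bracket. *)
Lemma Bombieri x y z :
  rnorm (inner x y) ^+ 2 + rnorm (inner x z) ^+ 2 <=
  rnorm x ^+ 2 *
    (Num.max (rnorm y ^+ 2) (rnorm z ^+ 2) + rnorm (inner y z)).
Proof.
set p := inner x y; set q := inner x z; set m := Num.max _ _.
set s := _ + _; set t := rnorm (inner y z).
have ym : rnorm y ^+ 2 <= m by rewrite le_max lexx.
have zm : rnorm z ^+ 2 <= m by rewrite le_max lexx orbT.
have t0 : 0 <= t := rnorm_ge0 _.
pose u := p *: y + q *: z.
have s0 : 0 <= s by rewrite addr_ge0 ?sqr_ge0.
have su : s <= rnorm x * rnorm u.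
  have -> : s = rnorm (inner x u).
    rewrite innerDr !innerZr -/p -/q !(mulrC (Num.conj _)) -!normCK !rnormE.
    by rewrite -!rmorphXn -rmorphD/= rnormC ger0_norm.
  exact: CauchySchwarz_inner.
have us : rnorm u ^+ 2 <= s * (m + t).
  rewrite rnorm_sqrD !rnormZ innerZl innerZr !exprMn.
  have h : complex.Re (p * (Num.conj q * inner y z)) <= rnorm p * rnorm q * t.
    apply: le_trans (ler_norm _) _; apply: le_trans (ler_Re_rnorm _) _.
    by rewrite !rnormM mulrA (_ : rnorm (Num.conj q) = rnorm q)// /rnorm norm_conjC.
  have := sqr_ge0 (rnorm p - rnorm q).
  by rewrite /s; move: (sqr_ge0 (rnorm p)) (sqr_ge0 (rnorm q)); nra.
have [->|sn0] := eqVneq s 0.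
  by rewrite mulr_ge0 ?sqr_ge0// addr_ge0// (le_trans _ ym) ?sqr_ge0.
have sp : 0 < s by rewrite lt_neqAle eq_sym sn0.
rewrite -(ler_pM2l sp) mulrCA; apply: le_trans (ler_wpM2l (sqr_ge0 _) us).
by rewrite -exprMn -expr2 ler_pXn2r ?nnegrE ?mulr_ge0 ?rnorm_ge0.
Qed.

Lemma rnorm_eq1 (V : normedZmodType R[i]) (x : V) : `|x| = 1 <-> rnorm x = 1.
Proof. by rewrite rnormE; split=> [/complexI|->]. Qed.

Lemma le_numerical_radius T x : bounded_operator T -> rnorm x = 1 ->
  rnorm (inner (T x) x) <= numerical_radius T.
Proof.
move=> /bounded_operatorP[_ [c c0 hc]] x1; apply: ub_le_sup.
  exists c => _ [y /rnorm_eq1 y1 <-].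
  apply: le_trans (CauchySchwarz_inner _ _) _.
  by rewrite y1 mulr1; apply: le_trans (hc _) _; rewrite y1 mulr1.
by exists x => //; apply/rnorm_eq1.
Qed.

Lemma le_operator_norm T x : bounded_operator T -> rnorm x <= 1 ->
  rnorm (T x) <= operator_norm T.
Proof.
move=> /bounded_operatorP[_ [c c0 hc]] x1; apply: ub_le_sup.
  exists c => _ [y /= + <-]; rewrite rnormE lecR => y1.
  by apply: le_trans (hc _) _; rewrite ler_piMr.
by exists x => //=; rewrite rnormE lecR.
Qed.

(** On the zero space there is no unit vector, the supremum is that of the empty
set and equals [0]; hence the hypothesis on [K]. *)
Lemma numerical_radius_le T (K : R) : 0 <= K ->
  (forall x, rnorm x = 1 -> rnorm (inner (T x) x) <= K) ->
  numerical_radius T <= K.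
Proof.
move=> K0 hK; rewrite /numerical_radius; set E := [set _ | _ in _].
have [->|E0] := eqVneq E set0; first by rewrite sup0.
by apply: ge_sup; [exact/set0P | move=> _ [x /rnorm_eq1 x1 <-]; exact: hK].
Qed.

Lemma numerical_radius_ge0 T : bounded_operator T -> 0 <= numerical_radius T.
Proof.
move=> bT; rewrite /numerical_radius; set E := [set _ | _ in _].
have [->|/set0P[_ [x /rnorm_eq1 x1 _]]] := eqVneq E set0; first by rewrite sup0.
exact: le_trans (rnorm_ge0 _) (le_numerical_radius bT x1).
Qed.

Lemma operator_norm_ge0 T : bounded_operator T -> 0 <= operator_norm T.
Proof.
move=> bT; apply: le_trans (rnorm_ge0 _) (le_operator_norm (x := 0) bT _).
by rewrite rnorm0.
Qed.

End Radius.

Theorem corollary2p4 (R : realType) (H : hilbertType R) (A B C D : H -> H)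
    (hA : bounded_operator A) (hB : bounded_operator B)
    (hC : bounded_operator C) (hD : bounded_operator D) :
  let P := abs_operator (adjoint A \o B) in
  let Q := abs_operator (C \o adjoint D) in
  numerical_radius ((adjoint B \o A) \+ (D \o adjoint C)) ^+ 2 <=
    2^-1 * (operator_norm ((P \o P) \+ (Q \o Q)) +
            operator_norm ((P \o P) \- (Q \o Q))) +
    numerical_radius (D \o adjoint C \o adjoint A \o B) +
    2 * numerical_radius (adjoint B \o A) * numerical_radius (D \o adjoint C).
Proof.
cbv zeta.
set P := abs_operator (adjoint A \o B); set Q := abs_operator (C \o adjoint D).
have bA' := bounded_adjoint hA; have bB' := bounded_adjoint hB.
have bC' := bounded_adjoint hC; have bD' := bounded_adjoint hD.
(* S and T are the adjoints X^* and Y^* of the two summands. *)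
pose S := adjoint A \o B; pose T := C \o adjoint D.
have bS : bounded_operator S by exact: bounded_operator_comp.
have bT : bounded_operator T by exact: bounded_operator_comp.
have bX : bounded_operator (adjoint B \o A) by exact: bounded_operator_comp.
have bY : bounded_operator (D \o adjoint C) by exact: bounded_operator_comp.
have bZ : bounded_operator (D \o adjoint C \o adjoint A \o B).
  exact: (bounded_operator_comp bY bS).
have PP : P \o P = adjoint S \o S by apply/funext => x; exact: abs_operator_sqr.
have QQ : Q \o Q = adjoint T \o T by apply/funext => x; exact: abs_operator_sqr.
have bSS := bounded_operator_comp (bounded_adjoint bS) bS.
have bTT := bounded_operator_comp (bounded_adjoint bT) bT.
rewrite PP QQ.
have bp := bounded_operator_add bSS bTT; have bm := bounded_operator_sub bSS bTT.
set wX := numerical_radius (adjoint B \o A); set wY := numerical_radius (D \o adjoint C).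
set wZ := numerical_radius (D \o _ \o _ \o _).
set Np := operator_norm (_ \+ _); set Nm := operator_norm (_ \- _).
have wX0 : 0 <= wX by exact: numerical_radius_ge0.
have wY0 : 0 <= wY by exact: numerical_radius_ge0.
have wZ0 : 0 <= wZ by exact: numerical_radius_ge0.
have Np0 : 0 <= Np by exact: operator_norm_ge0.
have Nm0 : 0 <= Nm by exact: operator_norm_ge0.
set K := _ + _ + _.
have K0 : 0 <= K by rewrite /K; nra.
rewrite -(sqr_sqrtr K0) ler_pXn2r ?nnegrE ?sqrtr_ge0 ?numerical_radius_ge0//; last first.
  exact: bounded_operator_add.
apply: numerical_radius_le; first exact: sqrtr_ge0.
move=> x x1; rewrite -(@ler_pXn2r _ 2) ?nnegrE ?sqrtr_ge0 ?rnorm_ge0// sqr_sqrtr//=.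
have XE : inner (adjoint B (A x)) x = inner x (S x).
  by rewrite [LHS]innerC -adjointP// -innerC -adjointP.
have YE : inner (D (adjoint C x)) x = inner x (T x).
  by rewrite adjointP// [LHS]innerC -adjointP// -innerC.
have ZE : inner (S x) (T x) = inner (D (adjoint C (S x))) x.
  by rewrite (adjointP hD) [RHS]innerC -(adjointP hC) -innerC.
have hX : _ <= wX := le_numerical_radius bX x1.
have hY : _ <= wY := le_numerical_radius bY x1.
have hZ : _ <= wZ := le_numerical_radius bZ x1.
rewrite /= in hX hY hZ; rewrite XE in hX; rewrite YE in hY; rewrite -ZE in hZ.
have hB2 := Bombieri x (S x) (T x); rewrite x1 expr1n mul1r in hB2.
have quad U : bounded_operator U -> complex.Re (inner (adjoint U (U x)) x) = rnorm (U x) ^+ 2.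
  by move=> bU; rewrite Re_innerC -adjointP// inner_self.
have le_op U : bounded_operator U -> `|complex.Re (inner (U x) x)| <= operator_norm U.
  move=> bU; apply: le_trans (ler_Re_rnorm _) _.
  apply: le_trans (CauchySchwarz_inner _ _) _.
  by rewrite x1 mulr1; apply: le_operator_norm => //; rewrite x1.
have hp : _ <= Np := le_op _ bp; have hm : _ <= Nm := le_op _ bm.
rewrite /= innerDl ReD !quad// in hp; rewrite /= innerBl ReD ReN !quad// in hm.
have hmax : Num.max (rnorm (S x) ^+ 2) (rnorm (T x) ^+ 2) <= 2^-1 * (Np + Nm).
  move: hp hm; rewrite !ler_norml => /andP[h1 h2] /andP[h3 h4].
  by rewrite ge_max; apply/andP; split; lra.
rewrite innerDl XE YE.
have := ler_rnormD (inner x (S x)) (inner x (T x)).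
set a := rnorm (inner x (S x)) in hX hB2 *; set b := rnorm (inner x (T x)) in hY hB2 *.
have a0 : 0 <= a := rnorm_ge0 _; have b0 : 0 <= b := rnorm_ge0 _.
have ab : a * b <= wX * wY by exact: ler_pM.
rewrite /K => hab.
have hab2 : rnorm (inner x (S x) + inner x (T x)) ^+ 2 <= (a + b) ^+ 2.
  by rewrite ler_pXn2r ?nnegrE ?rnorm_ge0 ?addr_ge0.
apply: le_trans hab2 _; rewrite sqrrD.
lra.
Qed.
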